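(* Let $r$ be an irrational real number and let $\lambda_r:\mathbb R\to\mathbb R$ be the automorphism $x \mapsto rx$. Then no locally o-minimal expansion of $(\mathbb R,<,0,+,\lambda_r)$ is quasi-periodic. In particular, let $\rho>1$ be a real number, let $E=\{\rho^n \mid n \in \mathbb Z,\ n\ge 0\}$, and let $\mathcal R$ be a semi-bounded o-minimal expansion of $(\mathbb R, <, +, 0, 1, (\lambda_s)_{s \in \mathbb R})$, where $\lambda_s$ is the map $x \mapsto sx$; then the locally o-minimal structure $\mathcal R_E=(\mathcal R,E)$ is not quasi-periodic.
   Context: ''Definable'' means definable with parameters. A structure $(\mathbb R,<,\ldots)$ expanding the ordered set of reals is locally o-minimal if for every definable set $X \subseteq \mathbb R$ and every $a \in \mathbb R$ there is an open interval $I$ containing $a$ such that $X \cap I$ is a union of finitely many points and finitely many open intervals. A locally o-minimal expansion of the ordered group of reals is called periodic if the set $r\mathbb Z$ is definable in it for some $r>0$; it is called quasi-periodic if it is a reduct of a periodic locally o-minimal expansion of the ordered group of reals. An o-minimal expansion $\mathcal R=(R,<,+,0,\ldots)$ of an ordered group is called semi-bounded if every set definable in $\mathcal R$ is already definable in the reduct $(R,0,1,+,<,(B_i)_{i \in I}, (\lambda)_{\lambda \in \Lambda})$, where $(B_i)_{i \in I}$ is the collection of all bounded sets definable in $\mathcal R$ and $\Lambda$ is the collection of all definable endomorphisms of $R$. Given such $\mathcal R$ as in the claim, $\mathcal R_E$ is the expansion of $\mathcal R$ by a unary predicate for $E$; it is known to be locally o-minimal. *)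

(* Defs.v *)
From HB Require Import structures.
From mathcomp Require Import all_boot all_order all_algebra.
From mathcomp Require Import boolp classical_sets cardinality reals ereal.
Set Implicit Arguments.
Unset Strict Implicit.
Unset Printing Implicit Defensive.
Import Order.TTheory GRing.Theory Num.Theory.
Local Open Scope classical_set_scope.
Local Open Scope ring_scope.

Section FirstOrderStructures.
Variable R : realType.

Definition operation := {n : nat & ('I_n -> R) -> R}.
Definition relation := {n : nat & set ('I_n -> R)}.

Definition cst_op (c : R) : operation :=
  existT (fun n => ('I_n -> R) -> R) 0%N (fun=> c).
Definition unary_op (f : R -> R) : operation :=
  existT (fun n => ('I_n -> R) -> R) 1%N (fun v => f (v ord0)).
Definition binary_op (f : R -> R -> R) : operation :=
  existT (fun n => ('I_n -> R) -> R) 2%N (fun v => f (v ord0) (v ord_max)).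
Definition unary_rel (P : set R) : relation :=
  existT (fun n => set ('I_n -> R)) 1%N [set v | P (v ord0)].
Definition binary_rel (P : R -> R -> Prop) : relation :=
  existT (fun n => set ('I_n -> R)) 2%N [set v | P (v ord0) (v ord_max)].

(* A first-order structure with underlying set R is given by its basic
   operations and relations; each of these serves as its own symbol, so the
   language is part of the structure. Constants are operations of arity 0. *)
Record structure := Structure {
  operations : set operation;
  relations : set relation }.

Section Definability.
Variable M : structure.

(* Terms and formulas in n free variables over the language of M enriched with
   a constant (Par) for every element of R. In Ex, variable 0 is the bound one
   and variable i.+1 is variable i of the context. *)
Inductive term (n : nat) : Type :=
| Var of 'I_n
| Par of R
| App (f : operation) of operations M f & ('I_(tag f) -> term n).

Inductive formula : nat -> Type :=
| Eq n of term n & term n : formula n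
| Rel n (P : relation) of relations M P & ('I_(tag P) -> term n) : formula n
| Not n of formula n : formula n
| And n of formula n & formula n : formula n
| Ex n of formula n.+1 : formula n.

Fixpoint eval n (v : 'I_n -> R) (t : term n) : R :=
  match t with
  | Var i => v i
  | Par c => c
  | App f _ args => tagged f (fun i => eval v (args i))
  end.

Definition extend n (a : R) (v : 'I_n -> R) : 'I_n.+1 -> R :=
  fun i => if unlift ord0 i is Some j then v j else a.

Fixpoint sat n (phi : formula n) : set ('I_n -> R) :=
  match phi with
  | Eq _ s t => fun v => eval v s = eval v t
  | Rel _ P _ args => fun v => tagged P (fun i => eval v (args i))
  | Not _ psi => fun v => ~ sat psi v
  | And _ psi chi => fun v => sat psi v /\ sat chi v
  | Ex _ psi => fun v => exists a, sat psi (extend a v)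
  end.

Definition definable n (X : set ('I_n -> R)) : Prop :=
  exists phi : formula n, X = sat phi.

Definition definable_subset (X : set R) : Prop :=
  definable [set v : 'I_1 -> R | X (v ord0)].

Definition definable_function (f : R -> R) : Prop :=
  definable [set v : 'I_2 -> R | v ord_max = f (v ord0)].

End Definability.

(* Reducts and expansions are taken in the sense of definability; in particular
   M is a reduct of N when its operations and relations are among those of N. *)
Definition reduct (M N : structure) : Prop :=
  forall n (X : set ('I_n -> R)), definable M X -> definable N X.
Definition expansion (N M : structure) : Prop := reduct M N.

Definition add_unary_predicate (M : structure) (E : set R) : structure :=
  Structure (operations M) (relations M `|` [set unary_rel E]).

Definition lt_rel : relation := binary_rel (fun x y => x < y).

Definition ordered_set : structure := Structure set0 [set lt_rel].

Definition ordered_group : structure :=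
  Structure [set cst_op 0; binary_op +%R] [set lt_rel].

Definition ordered_group_mul (r : R) : structure :=
  Structure [set cst_op 0; binary_op +%R; unary_op ( *%R r)] [set lt_rel].

Definition ordered_vector_space : structure :=
  Structure
    ([set cst_op 0; cst_op 1; binary_op +%R] `|`
     [set unary_op ( *%R s) | s in [set: R]])
    [set lt_rel].

Definition open_interval (I : set R) : Prop :=
  exists b c : \bar R, I = [set x | (b < x%:E)%E /\ (x%:E < c)%E].

Definition finite_union_points_intervals (X : set R) : Prop :=
  exists (F : set R) (J : set (set R)),
    [/\ finite_set F, finite_set J, J `<=` open_interval &
        X = F `|` \bigcup_(I in J) I].

Definition o_minimal (M : structure) : Prop :=
  expansion M ordered_set /\
  forall X, definable_subset M X -> finite_union_points_intervals X.

Definition locally_o_minimal (M : structure) : Prop :=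
  expansion M ordered_set /\
  forall X, definable_subset M X -> forall a : R,
    exists I, [/\ open_interval I, I a & finite_union_points_intervals (X `&` I)].

Definition periodic (M : structure) : Prop :=
  [/\ expansion M ordered_group, locally_o_minimal M &
      exists2 r : R, 0 < r & definable_subset M [set r * k%:~R | k in [set: int]]].

(* A reduct of a locally o-minimal structure in which < is definable is itself
   locally o-minimal, so that property of M is not repeated here. *)
Definition quasi_periodic (M : structure) : Prop :=
  expansion M ordered_group /\ exists2 N, periodic N & reduct M N.

Definition bounded_subset n (B : set ('I_n -> R)) : Prop :=
  exists C : R, forall v, B v -> forall i, `|v i| <= C.

(* The structure (R, 0, 1, +, <, (B_i)_i, (lambda)_lambda) attached to M. *)
Definition semi_bounded_part (M : structure) : structure :=
  Structure
    ([set cst_op 0; cst_op 1; binary_op +%R] `|`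
     [set unary_op f | f in
        [set f : R -> R | {morph f : x y / x + y} /\ definable_function M f]])
    ([set lt_rel] `|`
     [set B : relation | definable M (tagged B) /\ bounded_subset (tagged B)]).

Definition semi_bounded (M : structure) : Prop :=
  [/\ expansion M ordered_group, o_minimal M &
      reduct M (semi_bounded_part M)].

End FirstOrderStructures.

Arguments ordered_set {R}.
Arguments ordered_group {R}.
Arguments ordered_vector_space {R}.

(* Main.v *)
(** The idea is that periodicity makes $s\mathbb Z$ definable for some $s > 0$,
    and definability of $x \mapsto rx$ then makes the group
    $s\mathbb Z + rs\mathbb Z$ definable. In a locally o-minimal structure a
    definable subgroup of the reals either contains a neighbourhood of $0$, and
    then is everything, or is discrete, and then is cyclic. The first case is
    excluded by $s/2$ and the second one by the irrationality of $r$. *)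
Require Import Defs.
From mathcomp Require Import all_boot all_order all_algebra.
From mathcomp Require Import boolp classical_sets cardinality reals ereal.
From mathcomp Require Import ring lra zify.
Import Order.TTheory GRing.Theory Num.Theory.
Local Open Scope classical_set_scope.
Local Open Scope ring_scope.

(** * Closure properties of definable sets *)

Section Definability.
Context {R : realType}.
Implicit Types M N : structure R.

Lemma definable_not {M n} {X : set ('I_n -> R)} :
  definable M X -> definable M (~` X).
Proof. by move=> [phi ->]; exists (Not phi). Qed.

Lemma definable_and {M n} {X Y : set ('I_n -> R)} :
  definable M X -> definable M Y -> definable M (X `&` Y).
Proof. by move=> [phi ->] [psi ->]; exists (And phi psi). Qed.

Lemma definable_ex {M n} {X : set ('I_n.+1 -> R)} :
  definable M X -> definable M [set v | exists a, X (extend a v)].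
Proof. by move=> [phi ->]; exists (Ex phi). Qed.

Lemma extend0 n (a : R) (v : 'I_n -> R) : extend a v ord0 = a.
Proof. by rewrite /extend unlift_none. Qed.

Lemma extend_lift n (a : R) (v : 'I_n -> R) i :
  extend a v (lift ord0 i) = v i.
Proof. by rewrite /extend liftK. Qed.

(** Carries [h] under a quantifier: variable 0, the bound one, stays fixed, and [h] acts on the
    shifted context. *)
Definition lift_renaming {n m} (h : 'I_n -> 'I_m) (i : 'I_n.+1) : 'I_m.+1 :=
  if unlift ord0 i is Some j then lift ord0 (h j) else ord0.

Lemma extend_renaming n m (h : 'I_n -> 'I_m) a (v : 'I_m -> R) :
  extend a v \o lift_renaming h = extend a (v \o h).
Proof.
apply/funext => i; rewrite /extend /lift_renaming /=.
by case: (unlift ord0 i) => [j|]; rewrite ?liftK ?unlift_none.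
Qed.

Section Transfer.
Context {M N : structure R}.
Hypothesis operationsMN : operations M `<=` operations N.
Hypothesis relationsMN : relations M `<=` relations N.

Fixpoint transfer_term {n m} (h : 'I_n -> 'I_m) (t : term M n) : term N m :=
  match t with
  | Var i => Var N (h i)
  | Par c => Par N m c
  | App f Mf args => App (operationsMN _ Mf) (fun i => transfer_term h (args i))
  end.

Lemma eval_transfer n m (h : 'I_n -> 'I_m) (t : term M n) v :
  Defs.eval v (transfer_term h t) = Defs.eval (v \o h) t.
Proof.
elim: t => //= f Mf args IH; congr (tagged f _).
by apply/funext => i; exact: IH.
Qed.

(** One induction on formulas covers two uses: [M = N] gives preimages under reindexing of
    variables, and [h = id] gives passage to a larger language. The renaming stays general because
    the case of [Ex] calls the hypothesis at [lift_renaming h]. *)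
Lemma definable_transfer {n} {X : set ('I_n -> R)} {m} (h : 'I_n -> 'I_m) :
  definable M X -> definable N [set v : 'I_m -> R | X (v \o h)].
Proof.
move=> [phi ->]; elim: phi m h => {X} {}n.
- move=> s t m h; exists (Eq (transfer_term h s) (transfer_term h t)).
  by apply/funext => v /=; rewrite !eval_transfer.
- move=> P MP args m h.
  exists (Rel (relationsMN _ MP) (fun i => transfer_term h (args i))).
  apply/funext => v /=; congr (tagged P _).
  by apply/funext => i; rewrite eval_transfer.
- by move=> phi IH m h; exact: definable_not (IH m h).
- by move=> phi IHphi psi IHpsi m h; exact: definable_and (IHphi m h) (IHpsi m h).
- move=> phi IH m h.
  have := definable_ex (IH _ (lift_renaming h)).
  congr (definable _ _); apply/funext => v /=.
  by apply/propext; split=> -[a Ha]; exists a; move: Ha; rewrite extend_renaming.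
Qed.

End Transfer.

Lemma definable_preimage {M n} {X : set ('I_n -> R)} {m} (h : 'I_n -> 'I_m) :
  definable M X -> definable M [set v : 'I_m -> R | X (v \o h)].
Proof. exact: definable_transfer. Qed.

Lemma reduct_add_unary_predicate M E : reduct M (add_unary_predicate M E).
Proof. by move=> n X; apply: (definable_transfer _ _ id) => // P MP; left. Qed.

Lemma definable_unary_op {M} {f : R -> R} :
  operations M (unary_op f) -> definable_function M f.
Proof.
by move=> Mf; exists (Eq (Var M ord_max) (App Mf (fun=> Var M ord0))).
Qed.

(** Addition need not be a basic operation of [M], since [expansion] only compares definable sets.
    So the formula is written in the language of [ordered_group] and the set it defines is then
    carried to [M]. *)
Lemma definable_add {M n} (i j k : 'I_n) :
  expansion M ordered_group -> definable M [set v | v k = v i + v j].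
Proof.
apply; have op_add : operations (@ordered_group R) (binary_op +%R) by right.
exists (Eq (Var _ k)
  (App op_add (fun l => Var ordered_group (if l == ord0 then i else j)))).
by [].
Qed.

Lemma definable_sum_image {M} {P Q : set R} {f : R -> R} :
  expansion M ordered_group ->
  definable_subset M P -> definable_subset M Q -> definable_function M f ->
  definable_subset M [set a + f b | a in P & b in Q].
Proof.
move=> expM defP defQ deff.
pose i0 : 'I_4 := ord0; pose i1 : 'I_4 := lift ord0 ord0.
pose i2 : 'I_4 := lift ord0 (lift ord0 ord0).
pose i3 : 'I_4 := lift ord0 (lift ord0 (lift ord0 ord0)).
(* The four variables stand for [a], [b], [c = f b] and the sum [a + c]. The first three are
   quantified away, the outermost quantifier binding [c], and only [i3] remains free. *)
have := definable_ex (definable_ex (definable_ex (definable_and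
  (definable_and (definable_preimage (fun=> i0) defP)
                 (definable_preimage (fun=> i1) defQ))
  (definable_and (definable_preimage (fun i => if i == ord0 then i1 else i2) deff)
                 (definable_add i0 i2 i3 expM))))).
congr (definable _ _); apply/funext => v; apply/propext; split => /=.
  move=> [c [b [a]]].
  rewrite /i0 /i1 /i2 /i3 !(extend0, extend_lift) => -[[Pa Qb] [-> ->]].
  by exists a => //; exists b.
move=> [a Pa [b Qb abv]]; exists (f b), b, a.
by rewrite /i0 /i1 /i2 /i3 !(extend0, extend_lift) abv.
Qed.

End Definability.

(** * Subgroups of the reals: dense or cyclic *)

Section Subgroups.
Context {R : realType}.

Lemma open_interval_ball {I : set R} {y : R} : open_interval I -> I y ->
  exists2 e, 0 < e & forall z, `|z - y| < e -> I z.
Proof.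
move=> [b [c ->]] [].
have lower : (b < y%:E)%E ->
    exists2 e, 0 < e & forall z, `|z - y| < e -> (b < z%:E)%E.
  case: b => [b| |] //=; last by exists 1 => // z _; rewrite ltNyr.
  rewrite lte_fin => by_; exists (y - b); first by rewrite subr_gt0.
  by move=> z; rewrite ltr_norml lte_fin => /andP[]; lra.
have upper : (y%:E < c)%E ->
    exists2 e, 0 < e & forall z, `|z - y| < e -> (z%:E < c)%E.
  case: c => [c| |] //=; last by exists 1 => // z _; rewrite ltry.
  rewrite lte_fin => yc; exists (c - y); first by rewrite subr_gt0.
  by move=> z; rewrite ltr_norml lte_fin => /andP[]; lra.
move=> /lower[d d0 dP] /upper[e e0 eP]; exists (Num.min d e).
  by rewrite lt_min d0.
by move=> z; rewrite lt_min => /andP[/dP ? /eP ?].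
Qed.

Lemma finite_set_gap {F : set R} : finite_set F ->
  exists2 e, 0 < e & forall x, F x -> 0 < x -> e <= x.
Proof.
move=> /finite_seqP[s ->] {F}; elim: s => [|a s [e e0 IH]]; first by exists 1.
have [a0|a0] := ltP 0 a.
  exists (Num.min a e); first by rewrite lt_min a0.
  move=> x; rewrite /= inE ge_min => /orP[/eqP ->|xs x0]; first by rewrite lexx.
  by rewrite (IH x xs x0) orbT.
exists e => // x; rewrite /= inE => /orP[/eqP ->|]; last exact: IH.
by move=> /(le_lt_trans a0); rewrite ltxx.
Qed.

Context {X : set R}.
Hypotheses (X0 : X 0) (XB : forall x y, X x -> X y -> X (x - y)).

Lemma subgroup_mulrz x (k : int) : X x -> X (x * k%:~R).
Proof.
move=> Xx; have XN y : X y -> X (- y) by move=> Xy; rewrite -sub0r; exact: XB.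
have XMn n : X (x * n%:R).
  elim: n => [|n IH]; first by rewrite mulr0.
  have -> : x * n.+1%:R = x * n%:R - - x by rewrite -natr1; ring.
  by apply: XB => //; exact: XN.
case: k => n; first exact: XMn.
by rewrite NegzE mulrNz mulrN; exact/XN/XMn.
Qed.

(** By the Archimedean property [x / n] falls in the ball for some [n], and [x] is an integer
    multiple of it. *)
Lemma subgroup_full {e : R} : 0 < e -> (forall z, `|z| < e -> X z) ->
  forall x, X x.
Proof.
move=> e0 eX x.
have xe0 : 0 <= `|x| / e by rewrite divr_ge0// ltW.
pose n := Num.bound (`|x| / e); have ltn : `|x| / e < n%:R := archi_boundP xe0.
have n0 : 0 < n%:R :> R := le_lt_trans xe0 ltn.
have -> : x = x / n%:R * n%:Z%:~R by rewrite -pmulrn mulfVK// gt_eqF.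
apply: subgroup_mulrz; apply: eX.
by rewrite normrM normfV (gtr0_norm n0) ltr_pdivrMr// mulrC -ltr_pdivrMr.
Qed.

(** Distinct elements are at least [e] apart, so a positive element within [e] of the infimum is
    already the least one; division with remainder shows that it generates. *)
Lemma discrete_subgroup_cyclic {e : R} : 0 < e ->
  (forall x, X x -> 0 < x -> e <= x) -> (exists2 x, X x & 0 < x) ->
  exists g, forall x, X x -> exists k : int, x = g * k%:~R.
Proof.
move=> e0 gap [x1 Xx1 x10].
pose P := X `&` [set x | 0 < x].
have infP : has_inf P.
  by split; [exists x1 | exists 0 => x [_ /ltW]].
have [g [Xg g0] gltinf] := inf_adherent e0 infP.
have gmin x : X x -> 0 < x -> g <= x.
  move=> Xx x0; rewrite leNgt; apply/negP => xg.
  (* Here [g - x] would be a positive element below [e], because [g < inf P + e]. *)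
  have : inf P <= x by apply: ge_inf => //; exact: infP.2.
  have := gap _ (XB _ _ Xg Xx); rewrite subr_gt0 => /(_ xg); lra.
exists g => x Xx; exists (Num.floor (x / g)).
set k := Num.floor _.
have /andP[kle ltk] : k%:~R <= x / g < (k + 1)%:~R by exact: floor_itv.
(* The remainder lies in [[0, g)], so minimality of [g] forces it to vanish. *)
have Xr : X (x - g * k%:~R) by apply: XB => //; exact: subgroup_mulrz.
move: kle ltk; rewrite ler_pdivlMr// ltr_pdivrMr// intrD mulrDl mul1r mulrC => kle ltk.
apply/eqP; rewrite eq_le kle andbT leNgt; apply/negP; rewrite -subr_gt0.
by move/(gmin _ Xr); lra.
Qed.

(** If some interval of the decomposition is nonempty, translating it by one of its points puts a
    ball around 0 inside [X]. Otherwise [X] is finite near 0, hence has a gap there. *)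
Lemma locally_interval_subgroup {I : set R} :
  open_interval I -> I 0 -> finite_union_points_intervals (X `&` I) ->
  (forall x, X x) \/ exists2 e, 0 < e & forall x, X x -> 0 < x -> e <= x.
Proof.
move=> oI I0 [F [J [finF _ oJ XIE]]].
have [[K JK [y Ky]]|J0] := pselect (exists2 K, J K & K !=set0).
  left; have [e e0 eK] := open_interval_ball (oJ _ JK) Ky.
  have KX z : K z -> X z.
    by move=> Kz; have [] : (X `&` I) z by rewrite XIE; right; exists K.
  apply: (subgroup_full e0) => z ze.
  have -> : z = (z + y) - y by ring.
  by apply: XB; apply: KX => //; apply: eK; rewrite addrK.
right; have [d d0 dI] := open_interval_ball oI I0.
have [e e0 eF] := finite_set_gap finF.
(* A positive element below [d] lies in [I], hence in [F], whose positive members are at least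
   [e]. *)
exists (Num.min d e); first by rewrite lt_min d0.
move=> x Xx x0; rewrite ge_min; have [//|xd] := leP d x; apply: eF => //.
have : (X `&` I) x by split=> //; apply: dI; rewrite subr0 gtr0_norm.
by rewrite XIE => -[//|[K JK Kx]]; case: J0; exists K => //; exists x.
Qed.

End Subgroups.

(** * Irrational numbers *)

Section Irrationals.
Context {R : realType}.

Lemma irrational_mulz {r : R} {k m : int} :
  irrational r -> r * m%:~R = k%:~R -> m = 0.
Proof.
move=> irr rmk; apply: contrapT => /eqP m0; apply: irr.
exists (k%:~R / m%:~R) => //.
by rewrite fmorph_div /= !ratr_int -rmk mulfK// intr_eq0.
Qed.

Lemma irrational_sqrt2 : irrational (Num.sqrt 2 : R).
Proof.
move=> [q _ qE].
have q2 : q ^+ 2 = 2.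
  apply: (fmorph_inj (@ratr R)).
  by rewrite rmorphXn /= qE sqr_sqrtr// rmorph_nat.
have : numq q ^+ 2 = 2 * denq q ^+ 2.
  apply: (@intr_inj rat); rewrite [RHS]intrM !rmorphXn /=.
  by rewrite numqE exprMn q2.
move/(congr1 absz); rewrite abszM !abszX => nE.
(* The 2-adic valuation is even on the left and odd on the right. *)
have := congr1 (odd \o logn 2) nE.
have d0 : (0 < `|denq q|)%N by rewrite absz_gt0 denq_eq0.
by rewrite /= lognM ?expn_gt0 ?d0// !lognX (@logn_prime 2 2)//= !oddM.
Qed.

End Irrationals.

(** * Irrational multiplication against periodicity *)

Lemma irrational_mul_not_definable {R : realType} {r : R} {N : structure R} :
  irrational r -> periodic N -> ~ definable_function N ( *%R r).
Proof.
move=> irr [expN [_ lomN] [s s0 defsZ]] defr.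
have := definable_sum_image expN defsZ defsZ defr.
set X := (X in definable_subset N X) => /lomN /(_ 0)[I [oI I0 XI]].
have XE x : X x <-> exists k m : int, x = s * k%:~R + r * (s * m%:~R).
  split; first by move=> [_ [k _ <-] [_ [m _ <-] <-]]; exists k, m.
  move=> [k [m ->]]; exists (s * k%:~R); first by exists k.
  by exists (s * m%:~R) => //; exists m.
have X0 : X 0 by apply/XE; exists 0, 0; rewrite !mulr0 addr0.
have XB x y : X x -> X y -> X (x - y).
  move=> /XE[k [m ->]] /XE[k' [m' ->]]; apply/XE; exists (k - k'), (m - m').
  by rewrite !intrB; ring.
have [Xfull|[e e0 gap]] := locally_interval_subgroup X0 XB oI I0 XI.
  have /XE[k [m half]] := Xfull (s / 2).
  (* This is [s / 2 = s * k + r * s * m] cleared of [s] and of the denominator. Irrationality gives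
     [m = 0], and then 1 would be even. *)
  have rm : r * (2 * m)%:~R = (1 - 2 * k)%:~R.
    rewrite intrB !intrM; apply: (mulfI (lt0r_neq0 s0)); lra.
  have /eqP := irrational_mulz irr rm; rewrite mulf_eq0 /= => /eqP m0.
  move: rm; rewrite m0 mulr0 => /esym /eqP; rewrite intr_eq0 => /eqP; lia.
have Xs : X s by apply/XE; exists 1, 0; rewrite !mulr0 addr0 mulr1.
have Xrs : X (r * s) by apply/XE; exists 0, 1; rewrite mulr0 add0r mulr1.
have [g gX] := discrete_subgroup_cyclic X0 XB e0 gap (ex_intro2 _ _ s Xs s0).
have [[k sk] [m rsm]] := (gX _ Xs, gX _ Xrs).
have g0 : g != 0 by apply: contraTneq s0 => g0; rewrite sk g0 mul0r ltxx.
(* Both [s] and [r * s] are integer multiples of [g], so [r] times an integer is an integer; that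
   integer is then 0, which would give [s = 0]. *)
have /irrational_mulz : r * k%:~R = m%:~R.
  by apply: (mulfI g0); rewrite -rsm sk; ring.
by move=> /(_ irr) k0; move: s0; rewrite sk k0 mulr0 ltxx.
Qed.

Theorem proposition3p2 (R : realType) :
  (forall (r : R) (M : structure R),
     irrational r ->
     expansion M (ordered_group_mul r) ->
     locally_o_minimal M ->
     ~ quasi_periodic M) /\
  (forall (rho : R) (M : structure R),
     1 < rho ->
     expansion M ordered_vector_space ->
     o_minimal M ->
     semi_bounded M ->
     ~ quasi_periodic (add_unary_predicate M [set rho ^ n | n in [set n : int | 0 <= n]])).
Proof.
split.
  move=> r M irr expM _ [_ [N perN redMN]].
  apply: (irrational_mul_not_definable irr perN); apply/redMN/expM.
  by apply: definable_unary_op; right.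
move=> rho M _ expM _ _ [_ [N perN redMN]].
(* All real scalings are definable in [M], so any irrational scalar would do. *)
apply: (irrational_mul_not_definable irrational_sqrt2 perN).
apply/redMN/reduct_add_unary_predicate/expM.
by apply: definable_unary_op; right; exists (Num.sqrt 2).
Qed.
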